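(* (Riemann--Lebesgue Lemma) Let $\nu>-\frac12$. Then $\mathcal{F}_\nu$ maps $L^1(\mathbb{R}^+,x^{2\nu+1}\,dx)$ into $C_0(\mathbb{R}^+)$.
   Context: $\mathbb{R}^+=(0,\infty)$. $J_\nu(x)=\sum_{n=0}^\infty \frac{(-1)^n}{n!\,\Gamma(n+\nu+1)}\left(\frac{x}{2}\right)^{2n+\nu}$ is the Bessel function of the first kind and $\varphi_\nu(x)=x^{-\nu}J_\nu(x)$. The Fourier--Bessel transform of order $\nu$ is $\mathcal{F}_\nu f(y)=\int_{\mathbb{R}^+}\varphi_\nu(xy)f(x)x^{2\nu+1}\,dx$ for $y\in\mathbb{R}^+$. $C_0(\mathbb{R}^+)$ denotes the continuous functions on $\mathbb{R}^+$ that tend to $0$ at infinity. *)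

(* Defs.v *)
From HB Require Import structures.
From mathcomp Require Import all_boot all_order all_algebra.
From mathcomp Require Import complex.
From mathcomp Require Import all_classical all_reals all_analysis.

Set Implicit Arguments.
Unset Strict Implicit.
Unset Printing Implicit Defensive.

Import Order.TTheory GRing.Theory Num.Theory numFieldNormedType.Exports.

Local Open Scope classical_set_scope.
Local Open Scope complex_scope.
Local Open Scope ring_scope.

Definition Rplus (R : realType) : set R := `]0, +oo[.
Arguments Rplus {R}.

(* Euler's integral: it is Gamma(s) for 0 < s only. In [besselJ] it is
   evaluated at n + nu + 1, which is positive as soon as -1 < nu. *)
Definition Gamma (R : realType) (s : R) : R :=
  \int[lebesgue_measure]_(t in Rplus) (t `^ (s - 1) * expR (- t)).

(* [powR] is the real power for a positive base, so [besselJ nu x] and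
   [phi nu x] are meant for 0 < x. *)
Definition besselJ (R : realType) (nu x : R) : R :=
  limn (series (fun n : nat =>
    (-1) ^+ n / (n`!%:R * Gamma (n%:R + nu + 1))
      * (x / 2) `^ (2 * n%:R + nu))).

Definition phi (R : realType) (nu x : R) : R := x `^ (- nu) * besselJ nu x.

(* The library integrates real functions only; complex ones are measured and
   integrated through their real and imaginary parts. *)
Definition cmeasurable (R : realType) (D : set R) (h : R -> R[i]) : Prop :=
  measurable_fun D (fun x => complex.Re (h x)) /\
  measurable_fun D (fun x => complex.Im (h x)).

Definition cintegrable (R : realType) (D : set R) (h : R -> R[i]) : Prop :=
  lebesgue_measure.-integrable D (fun x => (complex.Re (h x))%:E) /\
  lebesgue_measure.-integrable D (fun x => (complex.Im (h x))%:E).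

Definition cintegral (R : realType) (D : set R) (h : R -> R[i]) : R[i] :=
  (\int[lebesgue_measure]_(x in D) complex.Re (h x)) +i*
  (\int[lebesgue_measure]_(x in D) complex.Im (h x)).

(* Representatives of L^1(R+, x^(2 nu + 1) dx); values outside R+ are
   irrelevant. [ComplexField.Normc.normc z : R] is the modulus of z. *)
Definition L1w (R : realType) (nu : R) : set (R -> R[i]) :=
  [set f | cmeasurable Rplus f /\
    (\int[lebesgue_measure]_(x in Rplus)
       (ComplexField.Normc.normc (f x) * x `^ (2 * nu + 1))%:E < +oo)%E].

Definition FBintegrand (R : realType) (nu : R) (f : R -> R[i]) (y x : R)
  : R[i] :=
  (phi nu (x * y))%:C * f x * (x `^ (2 * nu + 1))%:C.

Definition FourierBessel (R : realType) (nu : R) (f : R -> R[i]) (y : R)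
  : R[i] := cintegral Rplus (FBintegrand nu f y).

(* No condition at 0. The topology is that of the modulus: the library
   attaches it to R[i]^o, which is convertible to R[i]. *)
Definition C0 (R : realType) : set (R -> R[i]) :=
  [set g | {within Rplus, continuous (g : R -> R[i]^o)} /\
    (g y : R[i]^o) @[y --> +oo] --> (0 : R[i]^o)].
Arguments C0 {R}.

(* Main.v *)
Require Import Defs.
From HB Require Import structures.
From mathcomp Require Import all_boot all_order all_algebra.
From mathcomp Require Import complex ring lra.
From mathcomp Require Import all_classical all_reals all_analysis.
From mathcomp Require Import measurable_realfun.

Import Order.TTheory GRing.Theory Num.Theory numFieldNormedType.Exports.

Local Open Scope classical_set_scope.
Local Open Scope complex_scope.
Local Open Scope ring_scope.

(* By the functional equation of Gamma, phi = phi_nu is P x = g (x ^ 2) for an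
   entire power series g, and P'' + (p / x) P' + P = 0 with p = 2 nu + 1 > 0.
   The energy E = P ^ 2 + P' ^ 2 is thus nonincreasing on [0, +oo[, so that P is
   bounded. Moreover H = E + (p / x) P P' satisfies
   H' = - (p / x) E + O(x ^ -2); since H is bounded and E nonincreasing, this
   forces p ln x E(x) = O(1), so that P vanishes at infinity. The continuity of
   the transform and its limit at infinity then both follow from dominated
   convergence, without any density argument. *)

(** * Energy estimates for the Bessel equation *)

Lemma le_of_derive_le0 (R : realType) (f df : R -> R) (a b : R) :
    (forall x : R, a <= x <= b -> is_derive x 1 f (df x)) ->
    (forall x : R, a < x < b -> df x <= 0) ->
  a <= b -> f b <= f a.
Proof.
move=> fdf dfle0 ab.
apply: (@ler0_derive1_nincr _ f a b) => //.
- by move=> x; rewrite in_itv /= => /andP[ax xb]; have [] := fdf x; rewrite ?ltW.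
- move=> x; rewrite in_itv /= => axb; rewrite derive1E.
  have [|_ ->] := fdf x; last exact: dfle0.
  by case/andP: axb => ? ?; rewrite !ltW.
- by apply: derivable_within_continuous => x; rewrite in_itv /= => /fdf [].
Qed.

Section BesselEquation.
Variables (R : realType) (p : R) (P P1 P2 : R -> R).
Hypothesis p_gt0 : 0 < p.
Hypothesis dP : forall x : R, is_derive x 1 P (P1 x).
Hypothesis dP1 : forall x : R, is_derive x 1 P1 (P2 x).
Hypothesis odeP : forall x : R, 0 < x -> P2 x = - P x - p / x * P1 x.

Let E (x : R) : R := P x ^+ 2 + P1 x ^+ 2.

(** The equation gives [E' = 2 P1 (P + P2) = - 2 (p / t) P1 ^+ 2]. The sign is needed only inside
    the interval, so the end point [x = 0], where the equation says nothing, is allowed. *)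
Lemma energy_nonincreasing (x y : R) : 0 <= x -> x <= y -> E y <= E x.
Proof.
move=> x0.
apply: (@le_of_derive_le0 _ _ (fun x => 2 * P1 x * (P x + P2 x))) => t /andP[].
  by move=> _ _; apply: is_derive_eq; rewrite /GRing.scale /=; ring.
move=> xt _; have t0 := le_lt_trans x0 xt.
rewrite odeP // (_ : _ * _ = - (2 * (p / t) * P1 t ^+ 2)); last by ring.
by rewrite oppr_le0 mulr_ge0 ?sqr_ge0 // mulr_ge0 // divr_ge0 // ltW.
Qed.

Lemma bessel_solution_bounded (x : R) : 0 <= x -> `|P x| <= Num.sqrt (E 0).
Proof.
move=> x0; rewrite -sqrtr_sqr; apply: ler_wsqrtr.
by apply: le_trans (energy_nonincreasing _ _ (lexx 0) x0); rewrite lerDl sqr_ge0.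
Qed.

Lemma normM_le_energy (x : R) : 0 <= x -> `|P x * P1 x| <= E 0.
Proof.
move=> x0; apply: le_trans (energy_nonincreasing _ _ (lexx 0) x0).
by rewrite ler_norml /E; apply/andP; split; nra.
Qed.

Let H (x : R) : R := E x + p / x * (P x * P1 x).

(* The correction term turns the energy loss [- 2 (p / x) P1 ^+ 2] into
   [- (p / x) E] up to an integrable error. *)
Lemma energy_log_decay (x : R) : 1 <= x -> p * ln x * E x <= 2 * (1 + p) ^+ 2 * E 0.
Proof.
move=> x1; have x0 : 0 < x by lra.
have E0_ge0 : 0 <= E 0 by rewrite addr_ge0 ?sqr_ge0.
(* By the equation, [H' = - (p / t) E - p (1 + p) P P1 / t ^+ 2], and [C / t ^+ 2] bounds the last
   term. Adding [C / t] absorbs that term; adding [p * E x * ln t], with [E] frozen at the end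
   point, keeps [G] nonincreasing because [E x <= E t]. *)
pose C : R := p * (1 + p) * E 0.
pose G (t : R) : R := H t + p * E x * ln t + C / t.
have GxG1 : G x <= G 1.
  pose dG (t : R) : R := - (p / t) * (E t - E x)
    - p * (1 + p) * (E 0 + P t * P1 t) / t ^+ 2.
  apply: (@le_of_derive_le0 _ _ dG) => // t /andP[t1 tx].
    have t0 : 0 < t by lra.
    have dln := is_derive1_ln t0.
    have t_neq0 : t != 0 by rewrite gt_eqF.
    have dV : is_derive t (1:R) (fun y : R => y^-1) (- t ^- 2 *: 1).
      exact: is_deriveV.
    apply: is_derive_eq.
    by rewrite /dG /C /E odeP // /GRing.scale /=; field.
  have t0 : 0 < t by lra.
  have Ext : E x <= E t by apply: energy_nonincreasing; exact: ltW.
  have := normM_le_energy _ (ltW t0); rewrite ler_norml => /andP[PP1 _].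
  rewrite /dG mulNr -opprD oppr_le0.
  have EP : 0 <= E 0 + P t * P1 t by rewrite -lerBlDl sub0r.
  have [pt sqt] : 0 < p / t /\ 0 < t ^- 2.
    by rewrite divr_gt0 // invr_gt0 exprn_gt0.
  have pp : 0 < p * (1 + p) by rewrite mulr_gt0 ?addr_gt0.
  apply: addr_ge0; first by apply: mulr_ge0; [exact: ltW | rewrite subr_ge0].
  by apply: mulr_ge0; [apply: mulr_ge0; [exact: ltW | exact: EP] | exact: ltW].
have H1 : H 1 <= (1 + p) * E 0.
  have := energy_nonincreasing _ _ (lexx 0) ler01.
  have := normM_le_energy _ ler01; rewrite ler_norml => /andP[_ PP1] E1.
  by rewrite /H divr1 mulrDl mul1r lerD // ler_pM2l.
have Hx : - p * E 0 <= H x.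
  have Ex_ge0 : 0 <= E x by rewrite addr_ge0 ?sqr_ge0.
  have px : p / x <= p by rewrite ler_pdivrMr // ler_peMr // ltW.
  have px0 : 0 < p / x by rewrite divr_gt0.
  have := normM_le_energy _ (ltW x0); rewrite ler_norml => /andP[PP1 _].
  by rewrite /H; nra.
have C0 : 0 <= C.
  by apply: mulr_ge0 => //; apply: mulr_ge0; rewrite ?addr_ge0 // ltW.
have Cx : 0 <= C / x by rewrite divr_ge0 // ltW.
move: GxG1; rewrite /G ln1 mulr0 addr0 divr1 /C in Cx *.
have pE0 : 0 <= p * E 0 by apply: mulr_ge0; rewrite // ltW.
have ppE0 : 0 <= p * (p * E 0) by apply: mulr_ge0; rewrite // ltW.
rewrite mulrAC.
(* The first three terms bound [H 1], [C] and [- H x]; the bracket is a nonnegative surplus. *)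
rewrite (_ : 2 * _ * _ = (1 + p) * E 0 + p * (1 + p) * E 0 + p * E 0
  + (p * E 0 + p * (p * E 0) + E 0)); last by ring.
lra.
Qed.

(** Since [P x ^+ 2 <= E x], the logarithmic decay gives [ln x * P x ^+ 2 <= K] for [1 <= x]; once
    [ln x > K / e ^+ 2], this excludes [e <= |P x|]. *)
Lemma bessel_solution_cvg0 : P x @[x --> +oo] --> 0.
Proof.
pose K : R := 2 * (1 + p) ^+ 2 * E 0 / p.
apply/cvgrPdist_lt => e e0; near=> x.
have lnx : K / e ^+ 2 < ln x.
  near: x; exists (expR (K / e ^+ 2)); split; first exact: num_real.
  by move=> x /= h; rewrite -ltr_expR lnK // posrE (lt_trans _ h) ?expR_gt0.
have x1 : 1 <= x by near: x; exact: nbhs_pinfty_ge.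
rewrite sub0r normrN ltNge; apply/negP => ePx.
have E0_ge0 : 0 <= E 0 by rewrite addr_ge0 ?sqr_ge0.
have PE : e ^+ 2 <= E x.
  apply: (@le_trans _ _ (P x ^+ 2)); last by rewrite lerDl sqr_ge0.
  by rewrite -(real_normK (num_real (P x))) lerXn2r ?nnegrE // ltW.
have e2 : 0 < e ^+ 2 by rewrite exprn_gt0.
have decay : ln x * E x <= K.
  by rewrite /K ler_pdivlMr // mulrC mulrA energy_log_decay.
rewrite ltr_pdivrMr // in lnx.
have lnx0 : 0 <= ln x by exact: ln_ge0.
have lnE := ler_wpM2l lnx0 PE.
by have := lt_le_trans (lt_le_trans lnx lnE) decay; rewrite ltxx.
Unshelve. all: by end_near. Qed.
End BesselEquation.

(** * Continuity and decay of integrals with a dilated kernel *)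

Section Dilation.
Variables (R : realType) (P : R -> R) (C : R) (k : R -> R).
Notation mu := (@lebesgue_measure R).
Hypothesis cP : continuous P.
Hypothesis P_bounded : forall x : R, 0 <= x -> `|P x| <= C.
Hypothesis ik : mu.-integrable Rplus (EFin \o k).

Let T (y : R) : R := \int[mu]_(x in Rplus) (P (x * y) * k x).

Let mRplus : measurable (Rplus : set R).
Proof. exact: measurable_itv. Qed.

Let domination (x y : R) : 0 <= y -> Rplus x -> `|P (x * y) * k x| <= C * `|k x|.
Proof.
rewrite /Rplus /= in_itv /= andbT => y0 x0.
by rewrite normrM ler_wpM2r // P_bounded // mulr_ge0 // ltW.
Qed.

Let measurable_dilation (y : R) :
  measurable_fun Rplus (fun x => P (x * y) * k x).
Proof.
apply: measurable_funM; last by have /integrableP[/measurable_EFinP] := ik.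
apply: measurable_funTS; apply: continuous_measurable_fun => x.
apply: continuous_comp; last exact: cP.
by apply: continuousM; [exact: cvg_id|exact: cvg_cst].
Qed.

Let integrable_dominating : mu.-integrable Rplus (EFin \o (fun x => C * `|k x|)).
Proof.
have -> : EFin \o (fun x => C * `|k x|) = (fun x => (C%:E * `|(EFin \o k) x|)%E).
  by apply/funext => x /=; rewrite EFinM.
by apply: integrableZl => //; exact: integrable_abse.
Qed.

Lemma integrable_dilation (y : R) : 0 <= y ->
  mu.-integrable Rplus (EFin \o (fun x => P (x * y) * k x)).
Proof.
move=> y0; apply: le_integrable integrable_dominating => //.
  by apply/measurable_EFinP; exact: (measurable_dilation y).
by move=> x Rx /=; rewrite lee_fin (le_trans (domination _ _ y0 Rx)) ?ler_norm.
Qed.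

(** Continuity under the integral sign on the parameter interval []0, y + 1[]: the bound [C * |k x|]
    does not depend on the parameter. *)
Lemma continuous_integral_dilation (y : R) : 0 < y -> {for y, continuous T}.
Proof.
move=> y0.
have yI : y \in [set` `]0, y + 1[ : interval R].
  by rewrite inE /= in_itv /= y0 ltrDl ltr01.
apply: (@continuity_under_integral R _ _ mu (fun y x => P (x * y) * k x)
  Rplus mRplus 0 (y + 1) _ _ (fun x => C * `|k x|)) yI => //.
- move=> z; rewrite /= in_itv /= => /andP[/ltW z0 _]; exact: integrable_dilation.
- apply: aeW => x _ z _; apply: (@continuousM _ _ (fun l => P (x * l))).
    apply: continuous_comp; last exact: cP.
    by apply: continuousM; [exact: cvg_cst|exact: cvg_id].
  exact: cvg_cst.
- move=> z; rewrite /= in_itv /= => /andP[/ltW z0 _].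
  by apply: aeW => x Rx; exact: domination.
Qed.

(** The limit is tested along sequences [u] tending to [+oo], to which dominated convergence
    applies: for fixed [x > 0], [x * u n] tends to [+oo] as well, so the integrand tends to 0
    pointwise. *)
Lemma cvg0_integral_dilation : P x @[x --> +oo] --> 0 -> T y @[y --> +oo] --> 0.
Proof.
move=> P0; apply/cvg_pinftyP => u uoo.
(* [P] is bounded on nonnegative arguments only, so the sequence is shifted past the terms that may
   be nonpositive. *)
have [N _ u_gt0] : \forall n \near \oo, 0 < u n.
  by move/cvgryPgt : uoo; exact.
rewrite -(cvg_shiftn N).
pose f n x := (P (x * u (n + N)%N) * k x)%:E.
have [|||||] := @dominated_convergence _ _ _ mu Rplus mRplus f (cst 0%E)
  (EFin \o (fun x => C * `|k x|)).
- by move=> n; apply/measurable_EFinP; exact: measurable_dilation.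
- exact: measurable_cst.
- apply: aeW => x; rewrite /Rplus /= in_itv /= andbT => x0.
  apply: cvg_EFin; first exact: nearW.
  rewrite -(mul0r (k x)); apply: cvgM; last exact: cvg_cst.
  move/cvg_pinftyP : P0; apply; apply/cvgryPge => A.
  have /cvgryPge : u (n + N)%N @[n --> \oo] --> +oo.
    by apply: cvg_comp uoo; exact: cvg_addnr.
  by move/(_ (A / x)); apply: filterS => n; rewrite ler_pdivrMr // mulrC.
- exact: integrable_dominating.
- by apply: aeW => x n Rx; rewrite /f lee_fin domination // ltW // u_gt0 //= leq_addl.
move=> _ _; rewrite integral0 => /fine_cvg; exact.
Qed.
End Dilation.

(** * Complex modulus and convergence by components *)

Lemma normc_le (R : rcfType) (a b : R) :
  ComplexField.Normc.normc (a +i* b) <= `|a| + `|b|.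
Proof.
rewrite /= -[leRHS]ger0_norm ?addr_ge0 // -[leRHS]sqrtr_sqr ler_wsqrtr //.
rewrite -(real_normK (num_real a)) -(real_normK (num_real b)).
by rewrite sqrrD -addrA (addrC (_ *+ _)) addrA lerDl mulrn_wge0 ?mulr_ge0.
Qed.

Lemma norm_Re_le_normc (R : rcfType) (z : R[i]) :
  `|complex.Re z| <= ComplexField.Normc.normc z.
Proof.
by case: z => a b /=; rewrite -sqrtr_sqr ler_wsqrtr // lerDl sqr_ge0.
Qed.

Lemma norm_Im_le_normc (R : rcfType) (z : R[i]) :
  `|complex.Im z| <= ComplexField.Normc.normc z.
Proof.
by case: z => a b /=; rewrite -sqrtr_sqr ler_wsqrtr // lerDr sqr_ge0.
Qed.

Lemma cvg_complex (R : realType) (T : Type) (F : set_system T) (FF : Filter F)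
    (a b : T -> R) (la lb : R) :
  a @ F --> la -> b @ F --> lb ->
  (fun t => (a t +i* b t) : R[i]^o) @ F --> (la +i* lb : R[i]^o).
Proof.
move=> ala blb; apply/cvgrPdist_lt => -[e e'].
(* The radius is itself a complex number; being positive forces its imaginary part to be 0. *)
rewrite ltcE /= => /andP[/eqP -> e0].
have e20 : 0 < e / 2 by rewrite divr_gt0.
move/cvgrPdist_lt : ala => /(_ _ e20) ala.
move/cvgrPdist_lt : blb => /(_ _ e20) blb.
near=> t.
have at_ : `|la - a t| < e / 2 by near: t.
have bt : `|lb - b t| < e / 2 by near: t.
rewrite [ltLHS](_ : _ = (ComplexField.Normc.normc ((la - a t) +i* (lb - b t)))%:C) //.
rewrite ltcR; apply: le_lt_trans (normc_le _ _ _) _.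
by rewrite (splitr e) ltrD.
Unshelve. all: by end_near. Qed.

(** * The transform for a bounded kernel vanishing at infinity *)

Section BoundedKernel.
Variables (R : realType) (P : R -> R) (C : R).
Hypothesis cP : continuous P.
Hypothesis P_bounded : forall x : R, 0 <= x -> `|P x| <= C.
Hypothesis P_cvg0 : P x @[x --> +oo] --> 0.
Notation mu := (@lebesgue_measure R).
Variables (nu : R) (f : R -> R[i]).
Hypothesis phiE : forall x : R, 0 < x -> phi nu x = P x.
Hypothesis fL1 : L1w nu f.
(** The kernel is real, so the two parts of the transform are dilation integrals against [k1] and
    [k2]. There [phi nu] is replaced by [P], which is continuous on the whole line. *)
Let k1 (x : R) : R := complex.Re (f x) * x `^ (2 * nu + 1).
Let k2 (x : R) : R := complex.Im (f x) * x `^ (2 * nu + 1).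

Let FBRe (x y : R) : 0 < x -> 0 < y ->
  complex.Re (FBintegrand nu f y x) = P (x * y) * k1 x.
Proof.
move=> x0 y0; rewrite /FBintegrand /k1 phiE ?mulr_gt0 //.
by case: (f x) => a b /=; ring.
Qed.

Let FBIm (x y : R) : 0 < x -> 0 < y ->
  complex.Im (FBintegrand nu f y x) = P (x * y) * k2 x.
Proof.
move=> x0 y0; rewrite /FBintegrand /k2 phiE ?mulr_gt0 //.
by case: (f x) => a b /=; ring.
Qed.

Let mpow : measurable_fun Rplus (fun x : R => x `^ (2 * nu + 1)).
Proof. by apply: measurable_funTS; exact: measurable_powR. Qed.

Let weight (x : R) : R :=
  ComplexField.Normc.normc (f x) * x `^ (2 * nu + 1).

Let iweight : mu.-integrable Rplus (EFin \o weight).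
Proof.
have [[mRe mIm] fin] := fL1.
have w_ge0 x : 0 <= weight x.
  by rewrite mulr_ge0 ?powR_ge0 //; case: (f x) => a b; exact: sqrtr_ge0.
apply/integrableP; split; last first.
  by under eq_integral do rewrite /= ger0_norm //.
apply/measurable_EFinP; apply: measurable_funM => //.
rewrite (_ : (fun x => _) = (fun x =>
  Num.sqrt (complex.Re (f x) ^+ 2 + complex.Im (f x) ^+ 2))); last first.
  by apply/funext => x; case: (f x).
have msqrt : measurable_fun [set: R] (@Num.sqrt R).
  by apply: continuous_measurable_fun; exact: sqrt_continuous.
apply: measurableT_comp msqrt _.
by apply: measurable_funD; exact: measurable_funX.
Qed.

Let integrable_part (h : R[i] -> R) :
  measurable_fun Rplus (h \o f) ->
  (forall z, `|h z| <= ComplexField.Normc.normc z) ->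
  mu.-integrable Rplus (EFin \o (fun x => h (f x) * x `^ (2 * nu + 1))).
Proof.
move=> mh hle; apply: le_integrable iweight.
- exact: measurable_itv.
- by apply/measurable_EFinP; exact: measurable_funM.
- move=> x _; rewrite /= lee_fin !normrM ler_wpM2r //.
  by apply: le_trans (hle _) _; exact: ler_norm.
Qed.

Let ik1 : mu.-integrable Rplus (EFin \o k1).
Proof.
by case: fL1 => -[mRe _] _; apply: integrable_part => //; exact: norm_Re_le_normc.
Qed.

Let ik2 : mu.-integrable Rplus (EFin \o k2).
Proof.
by case: fL1 => -[_ mIm] _; apply: integrable_part => //; exact: norm_Im_le_normc.
Qed.

Lemma cintegrable_FBintegrand (y : R) : 0 < y ->
  cintegrable Rplus (FBintegrand nu f y).
Proof.
move=> y0; split.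
- have := integrable_dilation _ _ _ _ cP P_bounded ik1 _ (ltW y0).
  apply: eq_integrable; first exact: measurable_itv.
  by move=> x; rewrite inE /Rplus /= in_itv /= andbT => x0; rewrite /= FBRe.
- have := integrable_dilation _ _ _ _ cP P_bounded ik2 _ (ltW y0).
  apply: eq_integrable; first exact: measurable_itv.
  by move=> x; rewrite inE /Rplus /= in_itv /= andbT => x0; rewrite /= FBIm.
Qed.

Let T (k : R -> R) (y : R) : R := \int[mu]_(x in Rplus) (P (x * y) * k x).

Let FBE (y : R) : 0 < y -> FourierBessel nu f y = T k1 y +i* T k2 y.
Proof.
move=> y0; congr (_ +i* _); apply: eq_Rintegral => x;
  rewrite inE /Rplus /= in_itv /= andbT => x0.
- exact: FBRe.
- exact: FBIm.
Qed.

(** [FBE] describes the transform for [y > 0] only, which is enough both on the subspace [Rplus] and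
    near [+oo]. *)
Lemma C0_FourierBessel : C0 (FourierBessel nu f).
Proof.
split.
- apply: (@subspace_eq_continuous _ _ (R[i]^o) (fun y => T k1 y +i* T k2 y)).
    by move=> y; rewrite inE /Rplus /= in_itv /= andbT => y0; exact/esym/FBE.
  apply/continuous_in_subspaceT => y; rewrite inE /Rplus /= in_itv /= andbT => y0.
  apply: cvg_complex.
  + exact: (continuous_integral_dilation _ _ _ _ cP P_bounded ik1 _ y0).
  + exact: (continuous_integral_dilation _ _ _ _ cP P_bounded ik2 _ y0).
- have -> : (0 : R[i]^o) = (0 +i* 0 : R[i]^o) by [].
  apply: cvg_trans (cvg_complex _ _ _ _ _ _ _ _
    (cvg0_integral_dilation _ _ _ _ cP P_bounded ik1 P_cvg0)
    (cvg0_integral_dilation _ _ _ _ cP P_bounded ik2 P_cvg0)).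
  apply: near_eq_cvg; by near=> y; rewrite FBE.
Unshelve. all: by end_near. Qed.
End BoundedKernel.

(** * The functional equation of Gamma *)

Section GammaRecurrence.
Variable R : realType.
Notation mu := (@lebesgue_measure R).

(** For a natural number [n >= s] and [t >= 1], the power is at most [t ^+ n], whereas [expR t] is
    at least [t ^+ (n + 1) / (n + 1)!]; the product is thus at most [(n + 1)! / t]. *)
Lemma powR_expRN_cvg0 (s : R) : t `^ s * expR (- t) @[t --> +oo] --> (0:R).
Proof.
have [n sn] : exists n : nat, s <= n%:R.
  by exists (Num.truncn `|s|).+1; rewrite (le_trans (ler_norm s)) // ltW // truncnS_gt.
apply/cvgrPdist_le => e e0; near=> t.
have t1 : 1 <= t by near: t; exact: nbhs_pinfty_ge.
have t0 : 0 < t by exact: lt_le_trans t1.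
rewrite sub0r normrN ger0_norm ?mulr_ge0 ?powR_ge0 ?expR_ge0 //.
apply: (@le_trans _ _ (t ^+ n * expR (- t))).
  by rewrite ler_pM2r ?expR_gt0 // -powR_mulrn ?(ltW t0) // ler_powR.
rewrite expRN ler_pdivrMr ?expR_gt0 //.
have := expR_ge1Dxn n (ltW t0); move/(le_trans _) => tn.
have et : n.+1`!%:R <= e * t.
  by rewrite -ler_pdivrMl //; near: t; exact: nbhs_pinfty_ge.
apply: (@le_trans _ _ (e * (t ^+ n.+1 / n.+1`!%:R))); last first.
  by rewrite ler_pM2l // tn // lerDr.
rewrite mulrA ler_pdivlMr ?ltr0n ?fact_gt0 // exprS mulrA mulrC.
by rewrite ler_wpM2r // exprn_ge0 // ltW.
Unshelve. all: by end_near. Qed.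

(* The identity is proved between the extended integrals, where it follows by
   exhausting Rplus with the intervals [J n] and needs no integrability. *)
Lemma Gamma_rec (s : R) : 0 < s -> Gamma (s + 1) = s * Gamma s.
Proof.
move=> s0.
(* [A] and [B] are the integrands of [Gamma s] and [Gamma (s + 1)], and [B' = s * A - B] on positive
   arguments: this is the integration by parts. *)
pose A (t : R) : R := t `^ (s - 1) * expR (- t).
pose B (t : R) : R := t `^ s * expR (- t).
(* The shift by 2 keeps the end points distinct even at [n = 0]. *)
pose J (n : nat) : set R := `[n.+2%:R^-1, n.+2%:R]%classic.
have mJ n : measurable (J n) by exact: measurable_itv.
have J_gt0 n x : J n x -> 0 < x.
  rewrite /J /= in_itv /= => /andP[+ _]; apply: lt_le_trans.
  by rewrite invr_gt0.
have bigJ : \bigcup_n J n = Rplus.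
  apply/seteqP; split=> x; first by move=> [n _] /J_gt0; rewrite /Rplus /= in_itv /= andbT.
  rewrite /Rplus /= in_itv /= andbT => x0.
  exists (Num.truncn (Num.max x x^-1)) => //; rewrite /J /= in_itv /=.
  have xm : Num.max x x^-1 <= (Num.truncn (Num.max x x^-1)).+2%:R.
    by rewrite ltW // (lt_trans (truncnS_gt _)) // ltr_nat.
  have /andP[xl xr] : (x <= (Num.truncn (Num.max x x^-1)).+2%:R) &&
    (x^-1 <= (Num.truncn (Num.max x x^-1)).+2%:R) by rewrite -ge_max.
  by rewrite xl andbT invf_ple ?posrE.
have ndJ : nondecreasing_seq J.
  move=> m n mn; apply/subsetPset => x; rewrite /J /= !in_itv /= => /andP[lx xr].
  have mn2 : m.+2%:R <= n.+2%:R :> R by rewrite ler_nat !ltnS.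
  by rewrite (le_trans _ lx) ?(le_trans xr) // lef_pV2 ?posrE.
have mA : measurable_fun [set: R] A.
  apply: measurable_funM; first exact: measurable_powR.
  by apply: measurableT_comp => //; exact: measurableT_comp.
have mB : measurable_fun [set: R] B.
  apply: measurable_funM; first exact: measurable_powR.
  by apply: measurableT_comp => //; exact: measurableT_comp.
have A0 t : 0 <= A t by rewrite mulr_ge0 ?powR_ge0 ?expR_ge0.
have B0 t : 0 <= B t by rewrite mulr_ge0 ?powR_ge0 ?expR_ge0.
have intA : (\int[mu]_(t in J n) (A t)%:E)%E @[n --> \oo] -->
    (\int[mu]_(t in Rplus) (A t)%:E)%E.
  rewrite -bigJ; apply: ge0_nondecreasing_set_cvg_integral => //.
  - by move=> n; apply/measurable_EFinP; exact: measurable_funTS.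
  - by move=> n x _; rewrite lee_fin.
have intB : (\int[mu]_(t in J n) (B t)%:E)%E @[n --> \oo] -->
    (\int[mu]_(t in Rplus) (B t)%:E)%E.
  rewrite -bigJ; apply: ge0_nondecreasing_set_cvg_integral => //.
  - by move=> n; apply/measurable_EFinP; exact: measurable_funTS.
  - by move=> n x _; rewrite lee_fin.
have FTC n : (s%:E * (\int[mu]_(t in J n) (A t)%:E) =
  \int[mu]_(t in J n) (B t)%:E + (B n.+2%:R - B n.+2%:R^-1)%:E)%E.
  have ab : n.+2%:R^-1 < n.+2%:R :> R.
    by rewrite (@lt_trans _ _ 1) ?invf_lt1 ?ltr1n.
  have dB (t : R) : 0 < t -> is_derive t 1 B (s * A t - B t).
    move=> t0.
    have dp := @is_derive1_powR R s t t0.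
    by apply: is_derive_eq; rewrite /A /B /GRing.scale /=; ring.
  have dA (t : R) : 0 < t -> derivable A t 1.
    move=> t0; have dp := @is_derive1_powR R (s - 1) t t0.
    by apply: derivableM => //; apply: ex_derive.
  have cB t : 0 < t -> {for t, continuous B}.
    by move=> /dB[? _]; apply/differentiable_continuous/derivable1_diffP.
  have cA t : 0 < t -> {for t, continuous A}.
    by move=> /dA ?; apply/differentiable_continuous/derivable1_diffP.
  have cD (t : R) : 0 < t -> {for t, continuous (fun u : R => s * A u - B u)}.
    move=> t0; apply: cvgB; last exact: cB.
    by apply: cvgM; [exact: cvg_cst | exact: cA].
  have cJB : {within J n, continuous B}.
    by apply: continuous_in_subspaceT => x; rewrite inE => /J_gt0; exact: cB.
  have cJA : {within J n, continuous A}.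
    by apply: continuous_in_subspaceT => x; rewrite inE => /J_gt0; exact: cA.
  have cJD : {within J n, continuous (fun t => s * A t - B t)}.
    by apply: continuous_in_subspaceT => x; rewrite inE => /J_gt0; exact: cD.
  have cJ : compact (J n) by exact: segment_compact.
  have iA := continuous_compact_integrable cJ cJA.
  have iB := continuous_compact_integrable cJ cJB.
  have iD := continuous_compact_integrable cJ cJD.
  have FTC2 : (\int[mu]_(t in J n) (s * A t - B t)%:E =
      (B n.+2%:R)%:E - (B n.+2%:R^-1)%:E)%E.
    have a0 : 0 < n.+2%:R^-1 :> R by rewrite invr_gt0.
    apply: continuous_FTC2 => //.
      split=> [t||].
      - by rewrite in_itv /= => /andP[/(lt_trans a0) /dB []].
      - exact/cvg_at_right_filter/cB.
      - exact/cvg_at_left_filter/cB.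
    move=> t; rewrite in_itv /= => /andP[/(lt_trans a0) /dB [_ dBt] _].
    by rewrite derive1E dBt.
  rewrite EFinB -FTC2 -integralZl; [|exact: mJ|exact: iA].
  rewrite -integralD; [|exact: mJ|exact: iB|exact: iD].
  by apply: eq_integral => t _; rewrite -EFinM -EFinD addrC subrK.
(* The boundary terms vanish: at infinity by exponential decay, at 0 because [0 < s]. *)
have lim0 : (B n.+2%:R - B n.+2%:R^-1)%:E @[n --> \oo] --> 0%:E.
  apply: cvg_EFin; first exact: nearW.
  rewrite -[X in _ --> X](subrr 0); apply: cvgB.
    move/cvg_pinftyP : (powR_expRN_cvg0 s); apply.
    exact: cvg_comp (cvg_addnl 2) cvgr_idn.
  have B00 : B x @[x --> 0^'+] --> 0.
    rewrite -[X in _ --> X](mul0r (expR (- 0))); apply: cvgM; first exact: powR_cvg0.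
    apply: cvg_at_right_filter; apply: continuous_cvg; first exact: continuous_expR.
    exact: cvgN.
  move/cvg_at_rightP : B00; apply; split=> [n|]; first by rewrite invr_gt0.
  by have := @cvg_harmonic R; rewrite -cvg_shiftS.
have : (s%:E * \int[mu]_(t in Rplus) (A t)%:E = \int[mu]_(t in Rplus) (B t)%:E)%E.
  have h1 : (s%:E * (\int[mu]_(t in J n) (A t)%:E))%E @[n --> \oo] -->
    (s%:E * \int[mu]_(t in Rplus) (A t)%:E)%E.
    exact: cvgeZl.
  have h2 : (s%:E * \int[mu]_(t in J n) (A t)%:E)%E @[n --> \oo] -->
      (\int[mu]_(t in Rplus) (B t)%:E + 0)%E.
    under eq_cvg do rewrite FTC.
    (* The integral of [B] may still be [+oo] here; the sum of limits is defined because the other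
       limit is finite. *)
    by apply: cvgeD intB lim0; apply: fin_num_adde_defl; rewrite fin_numE.
  by rewrite adde0 in h2; exact: cvg_unique h1 h2.
move=> AB; rewrite /Gamma addrK /Rintegral -AB.
(* Real integrals are finite parts of extended ones, and [+oo] has finite part 0; the infinite case
   therefore reads [0 = s * 0]. Nonnegativity rules out [-oo]. *)
have : (0 <= \int[mu]_(t in Rplus) (A t)%:E)%E by apply: integral_ge0 => t _; rewrite lee_fin.
case: (\int[mu]_(t in Rplus) (A t)%:E)%E => [r||] //.
by rewrite gt0_muley ?lte_fin //= mulr0.
Qed.
End GammaRecurrence.

(** * Entire power series differentiated term by term *)

Section DominatedDerivedSeries.
Variable R : realType.
Implicit Type c : R ^nat.

(** As [pseries_diffs c n] is [(n + 1) * c (n + 1)], this forces factorial decay of [c]. It also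
    passes to the derived coefficients, so term by term differentiation can be iterated. *)
Definition diffs_dominated c :=
  forall n, `|pseries_diffs c n| <= `|c n|.

Lemma diffs_dominated_diffs c :
  diffs_dominated c -> diffs_dominated (pseries_diffs c).
Proof. by move=> cle n; rewrite [leLHS]normrM [leRHS]normrM ler_wpM2l. Qed.

Lemma diffs_dominated_fact c n : diffs_dominated c ->
  `|c n| <= `|c 0%N| / n`!%:R.
Proof.
move=> cle; elim: n => [|n IHn]; first by rewrite fact0 divr1.
rewrite factS natrM invfM mulrCA ler_pdivlMl ?ltr0n //.
by rewrite -[n.+1%:R]ger0_norm // -normrM; apply: le_trans (cle n) IHn.
Qed.

(** Comparison with [|c 0|] times the exponential series at [|x|]. *)
Lemma is_cvg_pseries_diffs_dominated c x : diffs_dominated c ->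
  cvgn (pseries c x).
Proof.
move=> cle; apply: (@normed_cvg _ R^o).
apply: (@series_le_cvg _ _ (`|c 0%N| *: exp_coeff `|x|)) => [n|n|n|].
- exact: normr_ge0.
- by rewrite mulr_ge0 // exp_coeff_ge0.
- rewrite /exp_coeff /= normrM normrX [leRHS]mulrCA [leRHS]mulrC ler_wpM2r ?exprn_ge0 //.
  exact: diffs_dominated_fact.
- by apply: is_cvg_seriesZ; exact: is_cvg_series_exp_coeff.
Qed.

Lemma is_derive_pseries c (x : R) : diffs_dominated c ->
  is_derive x 1 (fun y => limn (pseries c y)) (limn (pseries (pseries_diffs c) x)).
Proof.
move=> cle; apply: (@pseries_snd_diffs _ _ (`|x| + 1)).
- exact: is_cvg_pseries_diffs_dominated.
- exact/is_cvg_pseries_diffs_dominated/diffs_dominated_diffs.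
- by apply: is_cvg_pseries_diffs_dominated; do 2 apply: diffs_dominated_diffs.
- by rewrite [ltRHS]ger0_norm ?addr_ge0 // ltrDl.
Qed.
End DominatedDerivedSeries.
Arguments diffs_dominated {R} c.

(** * The Bessel power series and its differential equation *)

Section BesselSeries.
Variables (R : realType) (nu : R) (c : R ^nat).
Hypothesis nu_gt : - (1 / 2) < nu.
Hypothesis c_rec : forall n, 4 * (n%:R + nu + 1) * (n.+1%:R * c n.+1) = - c n.

Let c' := pseries_diffs c.
Let c'' := pseries_diffs c'.
Let g (d : R ^nat) (x : R) : R := limn (pseries d x).

(** The factor [4 * (n + nu + 1)] in [c_rec] is at least 1, since [nu > - 1 / 2]. *)
Lemma bessel_diffs_dominated : diffs_dominated c.
Proof.
move=> n; rewrite -[leRHS]normrN -c_rec -/(pseries_diffs c n) [leRHS]normrM.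
rewrite ler_peMl //.
by apply: le_trans (ler_norm _); move: nu_gt (ler0n R n); lra.
Qed.

(** The coefficient of [z ^+ n] on the left is [4 * (n + nu + 1) * c' n + c n], which is 0 by
    [c_rec]. *)
Lemma bessel_pseries_ode (z : R) :
  4 * z * g c'' z + 4 * (1 + nu) * g c' z + g c z = 0.
Proof.
have cd := bessel_diffs_dominated.
have cd' := diffs_dominated_diffs _ _ cd.
have cd'' := diffs_dominated_diffs _ _ cd'.
have s2 := pseries_diffs_equiv (is_cvg_pseries_diffs_dominated _ _ z cd'').
have s1 := is_cvg_pseries_diffs_dominated _ _ z cd'.
have s0 := is_cvg_pseries_diffs_dominated _ _ z cd.
(* [s i] is [i * c' i * z ^+ i.-1]: without the index shift of [c''], the three partial sums run
   over the same indices and cancel term by term. *)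
set s := (fun i => _) in s2.
have lim : 4 * z * series s n + 4 * (1 + nu) * pseries c' z n + pseries c z n
    @[n --> \oo] --> 4 * z * g c'' z + 4 * (1 + nu) * g c' z + g c z.
  apply: cvgD; last exact: s0.
  by apply: cvgD; apply: cvgM; [exact: cvg_cst|exact: s2|exact: cvg_cst|exact: s1].
rewrite -(cvg_lim _ lim) //; apply: lim_near_cst => //; apply: nearW => n.
rewrite /pseries /series /= !mulr_sumr -!big_split big1 // => i _ /=.
rewrite /s -[c i]opprK -c_rec -/(pseries_diffs c i) -/c'.
by case: i => [|i] /=; rewrite ?exprS -?[i.+1%:R]natr1; ring.
Qed.

Let P (x : R) : R := g c (x ^+ 2).
Let P1 (x : R) : R := 2 * x * g c' (x ^+ 2).
Let P2 (x : R) : R := 2 * g c' (x ^+ 2) + 4 * x ^+ 2 * g c'' (x ^+ 2).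

Let is_derive_g_sqr (d : R ^nat) (x : R) : diffs_dominated d ->
  is_derive x 1 (fun y => g d (y ^+ 2)) (2 * x * g (pseries_diffs d) (x ^+ 2)).
Proof.
move=> dd; have dg := is_derive_pseries _ _ (x ^+ 2) dd.
have dx : is_derive x 1 (fun y : R => y ^+ 2) (2 * x).
  by apply: is_derive_eq; rewrite /GRing.scale /=; ring.
by apply: is_derive_eq; rewrite mulrC.
Qed.

Lemma is_derive_bessel_pseries (x : R) : is_derive x 1 P (P1 x).
Proof. exact: is_derive_g_sqr bessel_diffs_dominated. Qed.

Lemma is_derive2_bessel_pseries (x : R) : is_derive x 1 P1 (P2 x).
Proof.
have dg := is_derive_g_sqr _ x (diffs_dominated_diffs _ _ bessel_diffs_dominated).
by rewrite /P1; apply: is_derive_eq; rewrite /P2 /GRing.scale /=; ring.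
Qed.

(** With [z = x ^+ 2], the terms [4 z g'' + 4 (1 + nu) g'] are exactly
    [P2 x + (2 nu + 1) / x * P1 x]. *)
Lemma bessel_pseries_bessel_eq (x : R) : 0 < x ->
  P2 x = - P x - (2 * nu + 1) / x * P1 x.
Proof.
move=> x0; have x_neq0 : x != 0 by rewrite gt_eqF.
have := bessel_pseries_ode (x ^+ 2) => /eqP; rewrite addr_eq0 => /eqP ode.
by rewrite /P -[g c _]opprK -ode /P1 /P2; field.
Qed.

Let p_gt0 : 0 < 2 * nu + 1.
Proof. by move: nu_gt; lra. Qed.

Lemma bessel_pseries_continuous : continuous P.
Proof.
move=> x; apply/differentiable_continuous/derivable1_diffP.
by have [] := is_derive_bessel_pseries x.
Qed.

Lemma bessel_pseries_bounded (x : R) :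
  0 <= x -> `|P x| <= Num.sqrt (P 0 ^+ 2 + P1 0 ^+ 2).
Proof.
exact: (bessel_solution_bounded _ _ _ _ _ p_gt0 is_derive_bessel_pseries
  is_derive2_bessel_pseries bessel_pseries_bessel_eq).
Qed.

Lemma bessel_pseries_cvg0 : P x @[x --> +oo] --> 0.
Proof.
exact: (bessel_solution_cvg0 _ _ _ _ _ p_gt0 is_derive_bessel_pseries
  is_derive2_bessel_pseries bessel_pseries_bessel_eq).
Qed.
End BesselSeries.

(** * Expansion of [phi] in powers of the squared variable *)

Section PhiSeries.
Variables (R : realType) (nu : R).
Hypothesis nu_gt : - (1 / 2) < nu.

(** The power of [x / 2] in [besselJ] splits into [x] to the [nu], which [phi] cancels,
    [(x ^+ 2) ^+ n], and the constants [2^-1] to the [nu] and [4 ^- n] kept here. *)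
Definition phi_coeff (n : nat) : R :=
  (-1) ^+ n / (n`!%:R * Gamma (n%:R + nu + 1)) * 2^-1 `^ nu / 4 ^+ n.

(** [Gamma_rec] at [n + nu + 1], which is positive, together with the factorial gives the ratio of
    consecutive coefficients. *)
Lemma phi_coeff_rec n :
  4 * (n%:R + nu + 1) * (n.+1%:R * phi_coeff n.+1) = - phi_coeff n.
Proof.
have nnu : 0 < n%:R + nu + 1 by move: nu_gt (ler0n R n); lra.
have -> : phi_coeff n.+1 =
    - phi_coeff n / (4 * n.+1%:R * (n%:R + nu + 1)).
  rewrite /phi_coeff -natr1 (_ : n%:R + 1 + nu + 1 = n%:R + nu + 1 + 1); last by ring.
  by rewrite Gamma_rec // natr1 factS natrM !exprS !invfM; ring.
by field; rewrite gt_eqF //= addrC natr1.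
Qed.

Lemma phi_pseries (x : R) : 0 < x ->
  phi nu x = limn (pseries phi_coeff (x ^+ 2)).
Proof.
move=> x0; rewrite /phi /besselJ.
have -> : (fun n : nat => (-1) ^+ n / (n`!%:R * Gamma (n%:R + nu + 1))
      * (x / 2) `^ (2 * n%:R + nu)) =
    x `^ nu *: (fun n => phi_coeff n * (x ^+ 2) ^+ n).
  apply/funext => n; rewrite /phi_coeff.
  rewrite powRD; last by rewrite (gt_eqF (divr_gt0 x0 _)) ?implybT.
  rewrite -natrM powR_mulrn ?divr_ge0 ?(ltW x0) // powRM ?(ltW x0) //.
  rewrite exprM (_ : (x / 2) ^+ 2 = x ^+ 2 / 4); last by field.
  by rewrite expr_div_n -[RHS]/(x `^ nu * _); ring.
(* Taking the scalar out of the limit requires convergence, which follows from the recurrence. *)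
rewrite lim_seriesZ; last first.
  apply: is_cvg_pseries_diffs_dominated.
  exact: bessel_diffs_dominated nu_gt phi_coeff_rec.
rewrite /GRing.scale /= mulrA -powRD; last by rewrite (gt_eqF x0) implybT.
by rewrite addNr powRr0 mul1r.
Qed.
End PhiSeries.

Theorem theorem4p8 (R : realType) (nu : R) (hnu : - (1 / 2) < nu)
    (f : R -> R[i]) (hf : L1w nu f) :
  (forall y : R, 0 < y -> cintegrable Rplus (FBintegrand nu f y)) /\
  C0 (FourierBessel nu f).
Proof.
have crec := @phi_coeff_rec R nu hnu.
have cP := bessel_pseries_continuous _ _ _ hnu crec.
have bP := bessel_pseries_bounded _ _ _ hnu crec.
have P0 := bessel_pseries_cvg0 _ _ _ hnu crec.
have phiE := @phi_pseries R nu hnu.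
split; last exact: (C0_FourierBessel _ _ _ cP bP P0 _ _ phiE hf).
exact: (cintegrable_FBintegrand _ _ _ cP bP _ _ phiE hf).
Qed.
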